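(* For $|t|=1$ and $1\le m\le8$, the normalized dimension-eight family $R(C_m(t))/\sqrt8$ has coefficient trace equal to the ordinary matrix trace, i.e. $\mathrm{Tr}(\Phi_n(x))=8^n\varepsilon_n(x)$ for all $n\ge1$ and $x\in\mathcal T_n$, and the forms $\mathrm{tr}_n=8^n\varepsilon_n$ are a scalar enhancement of the family $(r_i)$ with parameters $$(D,\alpha,\beta)=(8,1,\sqrt8).$$
   Context: Let $w=e^{2\pi\mathrm i/8}$. For $n\ge1$, $\mathcal T_n$ is the complex unital algebra generated by $U_1,\dots,U_{n-1}$ with $U_i^8=1$, $U_iU_{i+1}=wU_{i+1}U_i$, $U_iU_j=U_jU_i$ for $|i-j|>1$; it has basis the monomials $U_1^{k_1}\cdots U_{n-1}^{k_{n-1}}$, $0\le k_i\le7$ ($\mathcal T_1=\mathbb C$, $\mathcal T_n\subset\mathcal T_{n+1}$). $\varepsilon_n(x)$ is the coefficient of $1$ in $x$; for a scalar $D$ the coefficient trace is $D^n\varepsilon_n$. On $\mathbb C^8$ with orthonormal basis $e_j$, $j\in\mathbb Z/8\mathbb Z$, let $Xe_j=e_{j+1}$, $Ze_j=w^je_j$; $\Phi_n:\mathcal T_n\to\mathrm{End}((\mathbb C^8)^{\otimes n})$ is the representation $U_i\mapsto X_iZ_{i+1}$ (subscripts on $X$, $Z$ indicate tensor factors). For $\mathbf a=[a_0,\dots,a_7]$ put $R(\mathbf a)=\sum_ka_k(X\otimes Z)^k$. Set $I_{\alpha,\eta}(t)=[1,\alpha t,\eta,t,-1,\alpha t,-\eta,t]$,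 $II_{\delta,\beta}(t)=[1,\delta t,\beta,-t,1,-\delta t,\beta,t]$, and $C_1=I_{-\mathrm i,-1}$, $C_2=I_{-\mathrm i,1}$, $C_3=I_{\mathrm i,-1}$, $C_4=I_{\mathrm i,1}$, $C_5=II_{-1,-\mathrm i}$, $C_6=II_{-1,\mathrm i}$, $C_7=II_{1,-\mathrm i}$, $C_8=II_{1,\mathrm i}$. For given $m,t$, $r_i=8^{-1/2}\sum_{k=0}^7a_kU_i^k$ with $\mathbf a=C_m(t)$; these satisfy the braid relations, and $\Phi_n(r_i)$ is the copy of $R(C_m(t))/\sqrt8$ on tensor factors $i,i+1$. Scalar enhancement with parameters $\alpha,\beta\in\mathbb C^\times$: cyclic linear forms $\mathrm{tr}_n:\mathcal T_n\to\mathbb C$ ($\mathrm{tr}_n(xy)=\mathrm{tr}_n(yx)$, $n\ge1$) with $\mathrm{tr}_{n+1}(xr_n)=\alpha\beta\,\mathrm{tr}_n(x)$ and $\mathrm{tr}_{n+1}(xr_n^{-1})=\alpha^{-1}\beta\,\mathrm{tr}_n(x)$ for all $n\ge1$, $x\in\mathcal T_n$. *)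

(* Defs.v *)
From HB Require Import structures.
From mathcomp Require Import all_boot all_order all_algebra falgebra.
From mathcomp Require Import complex mxtens.
From mathcomp Require Import reals trigo.
From mathcomp Require Import ring.

Set Implicit Arguments.
Unset Strict Implicit.
Unset Printing Implicit Defensive.

Import Order.TTheory GRing.Theory Num.Theory.
Local Open Scope ring_scope.
Local Open Scope complex_scope.

Definition w8 (R : realType) : R[i] :=
  cos (2 * pi / 8) +i* sin (2 * pi / 8).

Lemma w8_expr8 (R : realType) : w8 R ^+ 8 = 1.
Proof.
have sq (x : R) : (cos x +i* sin x) * (cos x +i* sin x)
    = cos (x + x) +i* sin (x + x).
  apply/eqP; rewrite eq_complex /= cosD sinD eqxx /=.
  by rewrite addrC [cos x * _]mulrC.
rewrite (_ : w8 R ^+ 8 = w8 R ^+ 2 ^+ 2 ^+ 2); last by rewrite -!exprM.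
rewrite !expr2 /w8 !sq.
have sum8 (p : R) : let y := 2 * p / 8 in
    y + y + (y + y) + (y + y + (y + y)) = p *+ 2.
  move=> y; rewrite -!mulr2n -!mulrnA -[LHS]mulr_natr [LHS]divfK ?pnatr_eq0 //.
  exact: mulr_natl.
rewrite sum8.
by rewrite cos2pi sin2pi.
Qed.

(* The defining relations of the algebra, for the N = n - 1 elements
   u 0, ..., u (N - 1) standing for U_1, ..., U_(n-1). *)
Definition T_relations (R : realType) (N : nat) (A : algType R[i])
    (u : 'I_N -> A) : Prop :=
  [/\ forall i, u i ^+ 8 = 1,
      forall i j : 'I_N, j = i.+1 :> nat -> u i * u j = w8 R *: (u j * u i)
    & forall i j : 'I_N, (i.+1 < j)%N -> u i * u j = u j * u i].

(* The algebra is realised on its monomial basis: x : T R n is the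
   function sending the exponent vector k to the coefficient of
   U_1^(k 0) ... U_(n-1)^(k (n-2)) in x. That this is the algebra
   presented by T_relations is shown by T_relationsU, T_universal and
   T_monomial_basis below. *)
Definition T (R : realType) (n : nat) : Type :=
  {ffun {ffun 'I_n.-1 -> 'Z_8} -> R[i]^o}.

HB.instance Definition _ (R : realType) (n : nat) :=
  Vector.copy (T R n) {ffun {ffun 'I_n.-1 -> 'Z_8} -> R[i]^o}.

Section Algebra.
Variables (R : realType) (n : nat).
Local Notation C := R[i].
Local Notation N := n.-1.
Local Notation E := {ffun 'I_N -> 'Z_8}.
Local Notation w := (w8 R).
Implicit Types (k l m : E) (x y z : T R n) (a : 'Z_8).

(* U^k U^l = w^(- swap_exp k l) U^(k + l): moving U_i^(l_i) to the left
   of U_(i+1)^(k_(i+1)) costs w^(- k_(i+1) l_i). *)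
Definition swap_exp k l : 'Z_8 :=
  \sum_(i < N) \sum_(j < N | j == i.+1 :> nat) k j * l i.

Definition phase a : C := w ^- a.

Lemma w8_neq0 : w != 0.
Proof. by apply/eqP => w0; move/eqP: (w8_expr8 R); rewrite w0 expr0n /= eq_sym oner_eq0. Qed.

Lemma phase0 : phase 0 = 1.
Proof. by rewrite /phase expr0 invr1. Qed.

Lemma phaseD a b : phase (a + b) = phase a * phase b.
Proof. by rewrite /phase -invfM -exprD /= (expr_mod _ (w8_expr8 R)) exprD. Qed.

Lemma phase_neq0 a : phase a != 0.
Proof. by rewrite invr_neq0 ?expf_neq0 ?w8_neq0. Qed.

Lemma swap_expDl k l m : swap_exp (k + l) m = swap_exp k m + swap_exp l m.
Proof.
rewrite -big_split; apply: eq_bigr => i _; rewrite -big_split /=.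
by apply: eq_bigr => j _; rewrite ffunE mulrDl.
Qed.

Lemma swap_expDr k l m : swap_exp k (l + m) = swap_exp k l + swap_exp k m.
Proof.
rewrite -big_split; apply: eq_bigr => i _; rewrite -big_split /=.
by apply: eq_bigr => j _; rewrite ffunE mulrDr.
Qed.

Lemma swap_exp0l l : swap_exp 0 l = 0.
Proof. by apply: (addIr (swap_exp 0 l)); rewrite -swap_expDl !add0r. Qed.

Lemma swap_exp0r k : swap_exp k 0 = 0.
Proof. by apply: (addIr (swap_exp k 0)); rewrite -swap_expDr !add0r. Qed.

Definition T_one : T R n := [ffun k : E => (k == 0)%:R : C^o].

Definition T_mul x y : T R n :=
  [ffun m : E => \sum_k x k * y (m - k) * phase (swap_exp k (m - k))].

Fact T_mulA : associative T_mul.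
Proof.
move=> x y z; apply/ffunP => m; rewrite !ffunE.
under eq_bigr => k _ do rewrite ffunE.
under [RHS]eq_bigr => k _ do rewrite ffunE !mulr_suml.
rewrite [RHS]exchange_big /=; apply: eq_bigr => k _.
rewrite mulr_sumr mulr_suml [RHS](reindex_inj (addrI k)) /=.
apply: eq_bigr => l _; have -> : k + l - k = l by rewrite addrC addKr.
have -> : m - (k + l) = m - k - l by rewrite opprD addrA.
set q := m - k - l; have -> : m - k = l + q by rewrite [RHS]addrC subrK.
rewrite swap_expDl swap_expDr !phaseD.
by move: (phase _) (phase _) (phase _) => p1 p2 p3; ring.
Qed.

Fact T_mul1r : left_id T_one T_mul.
Proof.
move=> x; apply/ffunP => m; rewrite [LHS]ffunE (bigD1 (0 : E)) //= ffunE eqxx mul1r subr0.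
rewrite swap_exp0l phase0 mulr1 big1 ?addr0 // => k /negPf k0.
by rewrite ffunE k0 !mul0r.
Qed.

Fact T_mulr1 : right_id T_one T_mul.
Proof.
move=> x; apply/ffunP => m; rewrite [LHS]ffunE (bigD1 m) //= ffunE subrr eqxx mulr1.
rewrite swap_exp0r phase0 mulr1 big1 ?addr0 // => k /negPf km.
by rewrite ffunE subr_eq0 eq_sym km mulr0 mul0r.
Qed.

Fact T_mulDl : left_distributive T_mul +%R.
Proof.
move=> x y z; apply/ffunP => m; rewrite !ffunE -big_split /=.
by apply: eq_bigr => k _; rewrite ffunE !mulrDl.
Qed.

Fact T_mulDr : right_distributive T_mul +%R.
Proof.
move=> x y z; apply/ffunP => m; rewrite !ffunE -big_split /=.
by apply: eq_bigr => k _; rewrite ffunE mulrDr mulrDl.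
Qed.

Fact T_one_neq0 : T_one != 0.
Proof.
by apply/eqP => /ffunP/(_ 0)/eqP; rewrite !ffunE eqxx oner_eq0.
Qed.

HB.instance Definition _ := GRing.Zmodule_isNzRing.Build (T R n)
  T_mulA T_mul1r T_mulr1 T_mulDl T_mulDr T_one_neq0.

Fact T_scalerAl (c : C) x y : c *: (x * y) = (c *: x) * y.
Proof.
apply/ffunP => m; rewrite !ffunE scaler_sumr; apply: eq_bigr => k _.
by rewrite ffunE !scalerAl.
Qed.

HB.instance Definition _ := GRing.Lmodule_isLalgebra.Build C (T R n) T_scalerAl.

Fact T_scalerAr (c : C) x y : c *: (x * y) = x * (c *: y).
Proof.
apply/ffunP => m; rewrite !ffunE scaler_sumr; apply: eq_bigr => k _.
by rewrite ffunE scalerAl scalerAr.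
Qed.

HB.instance Definition _ := GRing.Lalgebra_isAlgebra.Build C (T R n) T_scalerAr.
HB.instance Definition _ := Algebra_isFalgebra.Build C (T R n).

End Algebra.

Section Lift.
Variables (R : realType) (n : nat).
Local Notation N := n.-1.
Local Notation C := R[i].
Local Notation w := (w8 R).
Variables (A : pzRingType) (c : C -> A) (u : 'I_N -> A).
Hypothesis c0 : c 0 = 0.
Hypothesis cD : {morph c : a b / a + b}.
Hypothesis c1 : c 1 = 1.
Hypothesis cM : {morph c : a b / a * b}.
Hypothesis cC : forall a x, c a * x = x * c a.
Hypothesis u8 : forall i, u i ^+ 8 = 1.
Hypothesis uw : forall i j : 'I_N, j = i.+1 :> nat -> u i * u j = c w * (u j * u i).
Hypothesis uC : forall i j : 'I_N, (i.+1 < j)%N -> u i * u j = u j * u i.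

Local Notation E := {ffun 'I_N -> 'Z_8}.
Implicit Types k l : E.

Let v (i : nat) : A := if insub i is Some j then u j else 1.
Let e k (i : nat) : 'Z_8 := if insub i is Some j then k j else 0.

Let v_ord (i : 'I_N) : v i = u i.
Proof. by rewrite /v valK. Qed.

Let e_ord k (i : 'I_N) : e k i = k i.
Proof. by rewrite /e valK. Qed.

Let v_out i : (N <= i)%N -> v i = 1.
Proof. by move=> Ni; rewrite /v insubN // -leqNgt. Qed.

Let e_out k i : (N <= i)%N -> e k i = 0.
Proof. by move=> Ni; rewrite /e insubN // -leqNgt. Qed.

Let v8 i : v i ^+ 8 = 1.
Proof.
case: (ltnP i N) => [iN|/v_out->]; last by rewrite expr1n.
by rewrite (v_ord (Ordinal iN)) u8.
Qed.

Let vC i j : (i.+1 < j)%N -> GRing.comm (v i) (v j).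
Proof.
move=> ij; case: (ltnP j N) => [jN|/v_out->]; last exact: commr1.
have iN : (i < N)%N by apply: ltn_trans jN; exact: ltnW.
by rewrite /GRing.comm (v_ord (Ordinal iN)) (v_ord (Ordinal jN)) uC.
Qed.

Let cV a b : a * b = 1 -> c a * c b = 1.
Proof. by rewrite -cM => ->. Qed.

Let vw1 i : (i.+1 < N)%N -> v i.+1 * v i = c w^-1 * (v i * v i.+1).
Proof.
move=> iN; rewrite (v_ord (Ordinal iN)) (v_ord (Ordinal (ltnW iN))).
by rewrite (@uw (Ordinal (ltnW iN)) (Ordinal iN)) // mulrA cV ?mul1r ?mulVf ?w8_neq0.
Qed.

Let vw i a b : (i.+1 < N)%N ->
  v i.+1 ^+ a * v i ^+ b = c (w ^- (a * b)) * (v i ^+ b * v i.+1 ^+ a).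
Proof.
move=> iN.
have H1 d : v i.+1 ^+ d * v i = c (w ^- d) * (v i * v i.+1 ^+ d).
  elim: d => [|d IH]; first by rewrite !expr0 invr1 c1 !mul1r mulr1.
  rewrite exprS -mulrA IH mulrA -cC -mulrA mulrA -mulrA [v i.+1 * (_ * _)]mulrA.
  rewrite vw1 // !mulrA -cM -!mulrA; congr (c _ * _).
  by rewrite exprS invfM mulrC.
elim: b => [|b IH]; first by rewrite muln0 !expr0 invr1 c1 !mul1r mulr1.
rewrite exprSr mulrA IH -!mulrA H1 mulnS exprD invfM cM.
rewrite -!mulrA [v i ^+ b * (_ * _)]mulrA -(cC _ (v i ^+ b)) -!mulrA.
by rewrite !mulrA -!cM mulrC -!mulrA.
Qed.

Let ph k l i : C := w ^- (e k i.+1 * e l i).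

Let vph k l i :
  v i.+1 ^+ e k i.+1 * v i ^+ e l i
  = c (ph k l i) * (v i ^+ e l i * v i.+1 ^+ e k i.+1).
Proof.
case: (ltnP i.+1 N) => [/vw//|iN].
by rewrite /ph (e_out k iN) mul0n !expr0 invr1 c1 !mul1r mulr1.
Qed.

Let P k j : A := \prod_(0 <= i < j) v i ^+ e k i.

Let eD k l i : v i ^+ e (k + l) i = v i ^+ e k i * v i ^+ e l i.
Proof.
rewrite -exprD; case: (ltnP i N) => [iN|iN].
  have ei m : e m i = m (Ordinal iN) := e_ord m (Ordinal iN).
  by rewrite !ei ffunE /= (expr_mod _ (v8 i)).
by rewrite !(e_out _ iN).
Qed.

Let P_comm k j m a : (j < m)%N -> GRing.comm (v m ^+ a) (P k j).
Proof.
move=> jm; rewrite /P big_nat; apply: commr_prod => i /= ij.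
apply: commrX; apply/commr_sym; apply: commrX; apply: vC.
exact: leq_ltn_trans jm.
Qed.

Let P_mul k l j :
  P k j * P l j = c (\prod_(0 <= i < j.-1) ph k l i) * P (k + l) j.
Proof.
elim: j => [|j IH]; first by rewrite /P !big_nil c1 !mul1r.
have PS m : P m j.+1 = P m j * v j ^+ e m j by rewrite /P big_nat_recr.
have swap : v j ^+ e k j * P l j
    = c (if j is i.+1 then ph k l i else 1) * (P l j * v j ^+ e k j).
  case: j {IH PS} => [|j]; first by rewrite /P !big_nil c1 !mul1r mulr1.
  have -> : P l j.+1 = P l j * v j ^+ e l j by rewrite /P big_nat_recr.
  rewrite mulrA (P_comm l _ (ltnSn j)) -mulrA vph mulrA -cC.
  by rewrite -!mulrA.
rewrite !PS -mulrA [v j ^+ _ * (_ * _)]mulrA swap -!mulrA mulrA -cC -!mulrA.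
rewrite [P k j * _]mulrA IH eD mulrA [c _ * (c _ * _)]mulrA -cM.
rewrite -!mulrA; congr (c _ * _).
by case: j {IH PS swap} => [|j] /=; rewrite ?mul1r // big_nat_recr //= mulrC.
Qed.

Let mono k : A := \prod_(i < N) u i ^+ k i.

Let monoP k : mono k = P k N.
Proof. by rewrite /P big_mkord; apply: eq_bigr => i _; rewrite v_ord e_ord. Qed.

Let phase_sum (I : finType) (Q : pred I) (F : I -> 'Z_8) :
  phase R (\sum_(i | Q i) F i) = \prod_(i | Q i) phase R (F i).
Proof. exact: (big_morph _ (@phaseD R) (phase0 R)). Qed.

Let phase_swap k l : phase R (swap_exp k l) = \prod_(0 <= i < N.-1) ph k l i.
Proof.
have -> : \prod_(0 <= i < N.-1) ph k l i = \prod_(0 <= i < N) ph k l i.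
  have : ph k l N.-1 = 1.
    rewrite /ph e_out ?mul0n ?expr0 ?invr1 //.
    by case: (N) => // m; rewrite leqnn.
  case: (N) => [|m] // /= phm; last by rewrite big_nat_recr //= phm mulr1.
rewrite big_mkord phase_sum; apply: eq_bigr => i _; rewrite phase_sum.
rewrite /ph e_ord; case: (ltnP i.+1 N) => iN; last first.
  rewrite e_out // mul0n expr0 invr1 big1 // => j ji.
  by move: (ltn_ord j); rewrite (eqP ji) ltnNge iN.
rewrite (big_pred1 (Ordinal iN)) => [|j]; last by rewrite /= -val_eqE.
rewrite (e_ord k (Ordinal iN)) /phase.
by rewrite /= (expr_mod _ (w8_expr8 R)).
Qed.

Let monoM k l : mono k * mono l = c (phase R (swap_exp k l)) * mono (k + l).
Proof. by rewrite !monoP P_mul phase_swap. Qed.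

Let lift (x : T R n) : A := \sum_k c (x k) * mono k.

Lemma lift_mul (x y : T R n) :
  \sum_m c ((x * y) m) * (\prod_(i < N) u i ^+ m i)
  = (\sum_k c (x k) * (\prod_(i < N) u i ^+ k i))
    * (\sum_l c (y l) * (\prod_(i < N) u i ^+ l i)).
Proof.
rewrite -/(lift (x * y)) -/(lift x) -/(lift y) /lift.
have c_sum (F : E -> C) : c (\sum_k F k) = \sum_k c (F k).
  exact: (big_morph c cD c0).
under eq_bigr => m _ do rewrite ffunE c_sum mulr_suml.
rewrite exchange_big mulr_suml /=; apply: eq_bigr => k _.
rewrite mulr_sumr (reindex_inj (addrI k)) /=; apply: eq_bigr => l _.
have -> : k + l - k = l by rewrite addrC addKr.
rewrite !cM -!mulrA -monoM; congr (_ * _).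
by rewrite !mulrA cC.
Qed.

Lemma lift_one :
  \sum_k c ((1 : T R n) k) * (\prod_(i < N) u i ^+ k i) = 1.
Proof.
rewrite (bigD1 (0 : E)) //= ffunE eqxx c1 mul1r big1; last first.
  by move=> i _; rewrite ffunE expr0.
rewrite big1 ?addr0 // => k /negPf k0.
by rewrite ffunE k0 c0 mul0r.
Qed.

End Lift.

Section Generators.
Variables (R : realType) (n : nat).
Local Notation N := n.-1.
Local Notation C := R[i].
Local Notation E := {ffun 'I_N -> 'Z_8}.
Implicit Types (k l m : E) (x y : T R n).

Let delta k : T R n := [ffun l : E => (l == k)%:R : C^o].
Let ex (i : 'I_N) : E := [ffun j => (j == i)%:R].

Definition U (i : 'I_n.-1) : T R n :=
  [ffun k : {ffun 'I_n.-1 -> 'Z_8} => (k == [ffun j => (j == i)%:R])%:R : C^o].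

Definition eps (x : T R n) : C := x 0.

Let UE i : U i = delta (ex i). Proof. by []. Qed.

Let delta1 : delta 0 = 1. Proof. by []. Qed.

Let deltaM k l : delta k * delta l = phase R (swap_exp k l) *: delta (k + l).
Proof.
apply/ffunP => m; rewrite !ffunE (bigD1 k) //= ffunE eqxx mul1r big1 ?addr0.
  rewrite ffunE subr_eq [l + k]addrC.
  case: eqP => [->|_]; last by rewrite mul0r scaler0.
  by rewrite addrAC subrr add0r mul1r [RHS]mulr1.
by move=> j /negPf jk; rewrite ffunE jk !mul0r.
Qed.

Let swap_ex i j (a b : nat) :
  swap_exp (ex i *+ a) (ex j *+ b) = (i == j.+1 :> nat)%:R *+ a *+ b.
Proof.
have exn h d t : (ex h *+ d) t = (t == h)%:R *+ d by rewrite ffunMnE ffunE.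
rewrite /swap_exp (bigD1 j) //= [X in _ + X]big1 ?addr0; last first.
  by move=> h /negPf hj; apply: big1 => t _; rewrite !exn hj mul0rn mulr0.
under eq_bigr => h _ do rewrite !exn eqxx.
have [ij|ij] := eqVneq (i : nat) j.+1.
  rewrite (bigD1 i) /= ?ij // eqxx big1 ?addr0 ?mulrnAr ?mulr1 //.
  by move=> h /andP[_ /negPf->]; rewrite mul0rn mul0r.
rewrite !mul0rn big1 // => h hj; have [hi|] := eqVneq h i.
  by rewrite -hi (eqP hj) eqxx in ij.
by rewrite mul0rn mul0r.
Qed.

Let UX i a : U i ^+ a = delta (ex i *+ a).
Proof.
elim: a => [|a IH]; first by rewrite mulr0n delta1.
rewrite exprSr IH UE deltaM -[X in swap_exp _ X]mulr1n swap_ex mulr1n.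
by rewrite (ltn_eqF (ltnSn i)) mul0rn phase0 scale1r mulrSr.
Qed.

Lemma T_relationsU : T_relations U.
Proof.
have UM i j : U i * U j = phase R (i == j.+1 :> nat)%:R *: delta (ex i + ex j).
  by rewrite !UE deltaM -[ex i as X in swap_exp X]mulr1n -[ex j as X in swap_exp _ X]mulr1n swap_ex !mulr1n.
split=> [i|i j ij|i j ij]; first 1 last.
- rewrite !UM ij eqxx [ex j + _]addrC scalerA.
  rewrite (ltn_eqF (ltnW (ltnSn i.+1))) phase0 /phase expr1.
  by rewrite mulfV ?w8_neq0.
- rewrite !UM [ex j + _]addrC (gtn_eqF ij).
  by rewrite (ltn_eqF (ltn_trans (ltnW ij) (ltnSn j))).
- rewrite UX -delta1; congr delta; apply/ffunP => j.
  rewrite ffunMnE !ffunE -[_ *+ 8]mulr_natr.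
  by rewrite (_ : 8%:R = 0 :> 'Z_8) ?mulr0 //; apply/val_inj.
Qed.

Let monomialE k : \prod_(i < N) U i ^+ k i = delta k.
Proof.
pose tr j : E := [ffun i : 'I_N => if (i < j)%N then k i else 0].
pose v i : T R n := if insub i is Some h then U h ^+ k h else 1.
have vE : \prod_(i < N) U i ^+ k i = \prod_(0 <= i < N) v i.
  by rewrite big_mkord; apply: eq_bigr => i _; rewrite /v valK.
have -> : delta k = delta (tr N).
  by congr delta; apply/ffunP => i; rewrite ffunE ltn_ord.
rewrite vE; suff H j : (j <= N)%N -> \prod_(0 <= i < j) v i = delta (tr j).
  exact: H.
elim: j => [_|j IH jN].
  by rewrite big_nil -delta1; congr delta; apply/ffunP => i; rewrite !ffunE.
rewrite big_nat_recr //= (IH (ltnW jN)) /v (@insubT _ (fun i => i < N)%N _ _ jN) /= UX deltaM.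
set h := Sub j jN; have hj : val h = j by [].
have -> : swap_exp (tr j) (ex h *+ k h) = 0.
  apply: big1 => i _; apply: big1 => t /eqP ti; rewrite !ffunMnE !ffunE.
  have [ih|] := eqVneq i h; last by rewrite mul0rn mulr0.
  by rewrite ti ih hj ltnNge leqnSn mul0r.
rewrite phase0 scale1r; congr delta; apply/ffunP => i.
rewrite !ffunE ffunMnE ffunE ltnS [(i <= j)%N]leq_eqVlt.
have [->|ih] := eqVneq i h; first by rewrite hj ltnn eqxx add0r natr_Zp.
by rewrite mul0rn addr0 -[j]hj (inj_eq val_inj) (negPf ih).
Qed.

Let coef_monomial_sum (c : E -> C) m :
  (\sum_k c k *: \prod_(i < N) U i ^+ k i) m = c m.
Proof.
have coef_sum (F : E -> T R n) : (\sum_k F k) m = \sum_k (F k m : C).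
  by apply: (big_morph (fun x : T R n => x m)) => [x y|]; rewrite ffunE.
rewrite coef_sum (bigD1 m) //= monomialE !ffunE eqxx [_ *: _]mulr1.
by rewrite big1 ?addr0 // => k km; rewrite monomialE !ffunE eq_sym (negPf km) scaler0.
Qed.

(* The ordered monomials form a basis, and x k is the coefficient of
   the k-th one in x; in particular eps x is the coefficient of 1. *)
Lemma T_expand x : x = \sum_k x k *: \prod_(i < n.-1) U i ^+ k i.
Proof. by apply/ffunP => m; rewrite coef_monomial_sum. Qed.

Lemma T_monomial_basis (c : {ffun 'I_n.-1 -> 'Z_8} -> R[i]) x :
  x = \sum_k c k *: \prod_(i < n.-1) U i ^+ k i <-> (forall k, x k = c k).
Proof.
split=> [-> m|xc]; first exact: coef_monomial_sum.
by rewrite {1}[x]T_expand; apply: eq_bigr => k _; rewrite xc.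
Qed.

Let monomial1 (A : pzRingType) (u : 'I_N -> A) i :
  \prod_(j < N) u j ^+ (ex i) j = u i.
Proof.
rewrite (big_only1 i) // => [|j /negPf ji _]; first by rewrite ffunE eqxx expr1.
by rewrite ffunE ji expr0.
Qed.

Lemma lift_gen (A : pzRingType) (c : C -> A) (u : 'I_n.-1 -> A) i :
  c 0 = 0 -> c 1 = 1 ->
  \sum_k c (U i k) * (\prod_(j < n.-1) u j ^+ k j) = u i.
Proof.
move=> c0 c1; rewrite (bigD1 (ex i)) //= ffunE eqxx c1 mul1r monomial1.
rewrite big1 ?addr0 // => k /negPf ki.
by rewrite ffunE -/(ex i) ki c0 mul0r.
Qed.

Lemma T_universal (A : algType R[i]) (u : 'I_n.-1 -> A) :
  T_relations u ->
  exists f : {lrmorphism T R n -> A},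
    (forall i, f (U i) = u i)
    /\ forall g : {lrmorphism T R n -> A}, (forall i, g (U i) = u i) -> g =1 f.
Proof.
case=> u8 uw uC.
pose f0 x : A := \sum_k x k *: \prod_(i < N) u i ^+ k i.
have f0E x : f0 x = \sum_k in_alg A (x k) * \prod_(i < N) u i ^+ k i.
  by apply: eq_bigr => k _; rewrite -scalerAl mul1r.
have aC a (x : A) : in_alg A a * x = x * in_alg A a.
  by rewrite /= -scalerAl -scalerAr mul1r mulr1.
have uw' (i j : 'I_N) : j = i.+1 :> nat ->
    u i * u j = in_alg A (w8 R) * (u j * u i).
  by move=> /uw->; rewrite /= -scalerAl mul1r.
have f0L : linear f0.
  move=> a x y; rewrite /f0 scaler_sumr -big_split /=; apply: eq_bigr => k _.
  by rewrite !ffunE scalerDl scalerA.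
have f0M : monoid_morphism f0.
  split=> [|x y]; rewrite !f0E.
    exact: (lift_one u (rmorph0 _) (rmorph1 _)).
  exact: (lift_mul (rmorph0 _) (rmorphD _) (rmorph1 _) (rmorphM _) aC u8 uw' uC).
pose Lm := GRing.isLinear.Build C (T R n) A _ f0 f0L.
pose Mm := GRing.isMonoidMorphism.Build (T R n) A f0 f0M.
pose f : {lrmorphism T R n -> A} := HB.pack f0 Lm Mm.
exists f; split=> [i|g gU x].
  rewrite [f _]f0E; exact: lift_gen (rmorph0 _) (rmorph1 _).
rewrite [in LHS](T_expand x) linear_sum; apply: eq_bigr => k _.
rewrite linearZ rmorph_prod; congr (_ *: _); apply: eq_bigr => i _.
by rewrite rmorphXn; congr (_ ^+ _); exact: gU.
Qed.

End Generators.

Section Inclusion.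
Variables (R : realType) (n : nat).

Definition incl (x : T R n) : T R n.+1 :=
  \sum_k x k *: \prod_(i < n.-1) U R (widen_ord (leq_pred n) i : 'I_n.+1.-1) ^+ k i.

Let u (i : 'I_n.-1) : T R n.+1 := U R (widen_ord (leq_pred n) i : 'I_n.+1.-1).

Let inclE x : incl x = \sum_k in_alg _ (x k) * \prod_(i < n.-1) u i ^+ k i.
Proof. by apply: eq_bigr => k _; rewrite -scalerAl mul1r. Qed.

Fact incl_is_linear : linear incl.
Proof.
move=> a x y; rewrite /incl scaler_sumr -big_split /=; apply: eq_bigr => k _.
by rewrite !ffunE scalerDl scalerA.
Qed.

Fact incl_is_monoid_morphism : monoid_morphism incl.
Proof.
have [u8 uw uC] := T_relationsU R n.+1.
have aC a (x : T R n.+1) : in_alg _ a * x = x * in_alg _ a.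
  by rewrite /= -scalerAl -scalerAr mul1r mulr1.
split=> [|x y]; rewrite !inclE.
  exact: (lift_one u (rmorph0 _) (rmorph1 _)).
apply: (lift_mul (rmorph0 _) (rmorphD _) (rmorph1 _) (rmorphM _) aC) => [i|i j ij|i j ij].
- exact: u8.
- by rewrite /= -scalerAl mul1r; exact: uw.
- exact: uC.
Qed.

HB.instance Definition _ := GRing.isLinear.Build R[i] (T R n) (T R n.+1) _
  incl incl_is_linear.
HB.instance Definition _ := GRing.isMonoidMorphism.Build (T R n) (T R n.+1)
  incl incl_is_monoid_morphism.

Lemma inclU i : incl (U R i) = U R (widen_ord (leq_pred n) i : 'I_n.+1.-1).
Proof. by rewrite inclE; exact: (lift_gen u i (rmorph0 _) (rmorph1 _)). Qed.

End Inclusion.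

Section Matrices.
Variables (R : realType) (n : nat).
Local Notation C := R[i].
Local Notation w := (w8 R).
Implicit Types (A B : 'M[C]_8).

(* Matrices act on columns: column j holds the image of e_j. *)
Definition Xmx : 'M[C]_8 := \matrix_(i, j) (i == j + 1)%:R.
Definition Zmx : 'M[C]_8 := \matrix_(i, j) (w ^+ j *+ (i == j)).

(* End((C^8)^(tensor n)), in the basis of the pure tensors
   e_(a 0) ... e_(a (n-1)) indexed by a : {ffun 'I_n -> 'I_8}. *)
Local Notation EndV := 'M[C]_#|{ffun 'I_n -> 'I_8}|.
Definition digits (a : 'I_#|{ffun 'I_n -> 'I_8}|) : {ffun 'I_n -> 'I_8} :=
  enum_val a.

Definition site (s : 'I_n) A : EndV :=
  \matrix_(a, b) \prod_l
    (if l == s then A else 1%:M) (digits a l) (digits b l).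

Fact site_l_subproof (i : 'I_n.-1) : (i < n)%N.
Proof. exact: leq_trans (ltn_ord i) (leq_pred n). Qed.
Fact site_r_subproof (i : 'I_n.-1) : (i.+1 < n)%N.
Proof. by rewrite -ltn_predRL. Qed.
Definition site_l (i : 'I_n.-1) : 'I_n := Ordinal (site_l_subproof i).
Definition site_r (i : 'I_n.-1) : 'I_n := Ordinal (site_r_subproof i).

Definition XZ (i : 'I_n.-1) : EndV :=
  site (site_l i) Xmx *m site (site_r i) Zmx.

Definition Phi (x : T R n) : EndV :=
  \sum_k x k *: \prod_(i < n.-1) XZ i ^+ k i.

Let tens (F : 'I_n -> 'M[C]_8) : EndV :=
  \matrix_(a, b) \prod_l F l (digits a l) (digits b l).

Let eq_tens F G : F =1 G -> tens F = tens G.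
Proof.
by move=> FG; apply/matrixP=> a b; rewrite !mxE; apply: eq_bigr => l _; rewrite FG.
Qed.

Let tensM F G : tens F *m tens G = tens (fun l => F l *m G l).
Proof.
apply/matrixP => a b; rewrite !mxE.
under [RHS]eq_bigr => l _ do rewrite mxE.
rewrite bigA_distr_bigA /= [RHS](reindex digits) /=; last first.
  by exists enum_rank => f _; rewrite /digits ?enum_valK ?enum_rankK.
apply: eq_bigr => c _.
by rewrite !mxE -big_split.
Qed.

Let tens1 : tens (fun=> 1%:M) = 1%:M.
Proof.
apply/matrixP => a b; rewrite !mxE; have [<-|ab] := eqVneq a b.
  by apply: big1 => l _; rewrite mxE eqxx.
have [l /negPf abl] : exists l, digits a l != digits b l.
  apply/existsP; apply: contraNT ab; rewrite negb_exists => /forallP abE.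
  apply/eqP/enum_val_inj/ffunP => l; apply/eqP.
  by have := abE l; rewrite negbK.
by rewrite (bigD1 l) //= mxE abl mul0r.
Qed.

Let siteM s A B : site s A *m site s B = site s (A *m B).
Proof.
rewrite [LHS]tensM; apply: eq_tens => l.
by case: ifP => // _; rewrite mulmx1.
Qed.

Let siteC s s' A B : s != s' -> site s A *m site s' B = site s' B *m site s A.
Proof.
move=> ss'; rewrite [LHS]tensM [RHS]tensM; apply: eq_tens => l.
have [->|_] := eqVneq l s; last by rewrite mul1mx mulmx1.
by rewrite (negPf ss') mul1mx mulmx1.
Qed.

Let siteZ s a A : site s (a *: A) = a *: site s A.
Proof.
apply/matrixP => i j; rewrite !mxE (bigD1 s) //= [in RHS](bigD1 s) //= eqxx.
rewrite mxE -mulrA; congr (_ * (_ * _)).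
by apply: eq_bigr => l /negPf->.
Qed.

Let site1 s : site s 1%:M = 1%:M.
Proof. by rewrite -tens1; apply: eq_tens => l; case: ifP. Qed.

Let siteX s A k : site s A ^+ k = site s (A ^+ k).
Proof.
elim: k => [|k IH]; first by rewrite !expr0 site1.
by rewrite !exprS IH; exact: siteM.
Qed.

Let X8 : Xmx ^+ 8 = 1.
Proof.
have XE k : Xmx ^+ k = \matrix_(i, j) (i == j + k%:R)%:R.
  elim: k => [|k IH]; first by apply/matrixP => i j; rewrite !mxE addr0.
  rewrite exprS IH; apply/matrixP => i j; rewrite !mxE (bigD1 (j + k%:R)) //=.
  rewrite !mxE eqxx mulr1 big1 ?addr0 -1?addrA -?natrD ?addn1 //.
    by rewrite -[in RHS]natr1 addrA.
  by move=> l /negPf lj; rewrite !mxE lj mulr0.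
rewrite XE; apply/matrixP => i j; rewrite !mxE.
by rewrite (_ : 8%:R = 0 :> 'I_8) ?addr0 //; apply/val_inj.
Qed.

Let Z8 : Zmx ^+ 8 = 1.
Proof.
have ZE k : Zmx ^+ k = \matrix_(i, j) (w ^+ (j * k) *+ (i == j)).
  elim: k => [|k IH]; first by apply/matrixP => i j; rewrite !mxE muln0.
  rewrite exprSr IH; apply/matrixP => i j; rewrite !mxE (bigD1 j) //=.
  rewrite !mxE eqxx mulrnAl -exprD mulnSr big1 ?addr0 //.
  by move=> l /negPf lj; rewrite !mxE lj mulr0.
rewrite ZE; apply/matrixP => i j; rewrite !mxE.
by rewrite mulnC exprM w8_expr8 expr1n.
Qed.

Let ZX : Zmx *m Xmx = w *: (Xmx *m Zmx).
Proof.
apply/matrixP => i j; rewrite !mxE.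
rewrite (bigD1 (j + 1)) //= [in RHS](bigD1 j) //= !mxE eqxx mulr1.
rewrite !big1 ?addr0; first last.
- by move=> l /negPf lj; rewrite !mxE lj mulr0.
- by move=> l /negPf lj; rewrite !mxE lj mulr0.
rewrite eqxx mulrCA -exprS mulr_natl; congr (_ *+ _).
by rewrite /= (expr_mod _ (w8_expr8 R)) addn1.
Qed.

Let lr i : site_l i != site_r i.
Proof. by rewrite -val_eqE /= (ltn_eqF (ltnSn i)). Qed.

Let XZ8 i : XZ i ^+ 8 = 1.
Proof.
rewrite [LHS]exprMn_comm; last exact: siteC (lr i).
by rewrite !siteX X8 Z8 !site1; exact: mulmx1.
Qed.

Let XZw (i j : 'I_n.-1) : j = i.+1 :> nat -> XZ i * XZ j = (w%:M : EndV) * (XZ j * XZ i).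
Proof.
move=> ji; have rl : site_r i = site_l j by apply/val_inj.
rewrite /XZ rl -![_ * _]/(_ *m _) mul_scalar_mx.
have ij : site_l i != site_r j by rewrite -val_eqE /= ji ltn_eqF // ltnW.
have ill : site_l i != site_l j by rewrite -rl lr.
rewrite -!mulmxA [site _ Zmx *m (site _ Xmx *m _)]mulmxA siteM ZX siteZ -siteM.
rewrite -scalemxAl -scalemxAr; congr (_ *: _).
rewrite [in RHS](mulmxA (site (site_r j) _)) -(siteC _ _ ij) -!mulmxA.
rewrite -(siteC Zmx Zmx (lr j)) [LHS]mulmxA [RHS]mulmxA.
by rewrite (siteC _ _ ill).
Qed.

Let XZC (i j : 'I_n.-1) : (i.+1 < j)%N -> XZ i * XZ j = XZ j * XZ i.
Proof.
move=> ij; apply: commrM; apply/commr_sym; apply: commrM; apply: siteC;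
  by rewrite -val_eqE /= gtn_eqF // ?ltnS ltnW // ltnW.
Qed.

Let PhiE x : Phi x = \sum_k (x k)%:M * \prod_(i < n.-1) XZ i ^+ k i.
Proof. by apply: eq_bigr => k _; rewrite -mul_scalar_mx. Qed.

Fact Phi_is_linear : linear Phi.
Proof.
move=> a x y; rewrite /Phi scaler_sumr -big_split /=; apply: eq_bigr => k _.
by rewrite !ffunE scalerDl scalerA.
Qed.

Fact Phi_is_monoid_morphism : monoid_morphism Phi.
Proof.
have sM : {morph (@scalar_mx C #|{ffun 'I_n -> 'I_8}|) : a b / a * b}.
  by move=> a b; exact: scalar_mxM.
have sC a (M : EndV) : a%:M * M = M * a%:M.
  exact: esym (scalar_mxC _ _).
split=> [|x y]; rewrite !PhiE.
  by apply: lift_one => //; exact: raddf0.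
exact: (lift_mul (raddf0 _) (raddfD _) _ sM sC XZ8 XZw XZC).
Qed.

HB.instance Definition _ := GRing.isLinear.Build C (T R n)
  EndV _ Phi Phi_is_linear.
HB.instance Definition _ := GRing.isMonoidMorphism.Build (T R n)
  EndV Phi Phi_is_monoid_morphism.

Lemma PhiU i : Phi (U R i) = XZ i.
Proof. by rewrite PhiE; apply: (lift_gen _ i) => //; exact: raddf0. Qed.

(* The copy on tensor factors s, s' of an operator on C^8 tensor C^8,
   the latter being indexed as in the Kronecker product *t. *)
Definition place (s s' : 'I_n) (M : 'M[C]_(8 * 8)) : EndV :=
  \matrix_(a, b) (M (mxtens_index (digits a s, digits a s'))
                     (mxtens_index (digits b s, digits b s'))
    * \prod_(l | (l != s) && (l != s')) (digits a l == digits b l)%:R).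

Let place_tens s s' A B : s != s' ->
  place s s' (A *t B) = site s A *m site s' B.
Proof.
move=> ss'; rewrite [RHS]tensM.
rewrite (@eq_tens _ (fun l => if l == s then A else if l == s' then B else 1%:M)).
  apply/matrixP => a b; rewrite !mxE !mxtens_indexK.
  rewrite [in RHS](bigD1 s) //= [in RHS](bigD1 s') 1?eq_sym //= !eqxx.
  rewrite [s' == s]eq_sym (negPf ss') mulrA; congr (_ * _).
  by apply: eq_bigr => l /andP[/negPf-> /negPf->]; rewrite mxE.
move=> l; have [->|_] := eqVneq l s; last by rewrite mul1mx.
by rewrite (negPf ss') mulmx1.
Qed.

Let placeZ s s' a M : place s s' (a *: M) = a *: place s s' M.
Proof. by apply/matrixP => i j; rewrite !mxE mulrA. Qed.

Let place_sum s s' (I : finType) (F : I -> 'M[C]_(8 * 8)) :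
  place s s' (\sum_i F i) = \sum_i place s s' (F i).
Proof.
apply: (big_morph (place s s')) => [M M'|]; apply/matrixP => i j.
  by rewrite !mxE mulrDl.
by rewrite !mxE mul0r.
Qed.

Definition Rmx (a : seq C) : 'M[C]_(8 * 8) :=
  \sum_(k < 8) a`_k *: (Xmx *t Zmx) ^+ k.

Definition braid_gen (a : seq C) (i : 'I_n.-1) : T R n :=
  (sqrtC 8)^-1 *: \sum_(k < 8) a`_k *: U R i ^+ k.

Lemma Phi_braid_gen a i :
  Phi (braid_gen a i)
  = place (site_l i) (site_r i) ((sqrtC 8)^-1 *: Rmx a).
Proof.
rewrite linearZ linear_sum placeZ place_sum; congr (_ *: _).
apply: eq_bigr => k _; rewrite linearZ rmorphXn placeZ; congr (_ *: _).
have -> : (Xmx *t Zmx) ^+ k = Xmx ^+ k *t Zmx ^+ k.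
  elim: (k : nat) => [|d IH]; last by rewrite !exprS IH; exact: tensmx_mul.
  apply/matrixP => i' j'; case: (mxtens_indexP i') => i0 i1.
  case: (mxtens_indexP j') => j0 j1.
  rewrite tensmxE !mxE (can_eq (@mxtens_indexK _ _)) xpair_eqE.
  by do 2!case: eqP => _; rewrite ?mulr1 ?mulr0.
rewrite place_tens // -!siteX.
transitivity (XZ i ^+ k); first by congr (_ ^+ _); exact: PhiU.
by apply: exprMn_comm; exact: siteC.
Qed.

End Matrices.

Definition family_I (R : realType) (alpha eta t : R[i]) : seq R[i] :=
  [:: 1; alpha * t; eta; t; -1; alpha * t; - eta; t].

Definition family_II (R : realType) (delta beta t : R[i]) : seq R[i] :=
  [:: 1; delta * t; beta; - t; 1; - (delta * t); beta; t].

Definition family_C (R : realType) (m : nat) (t : R[i]) : seq R[i] :=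
  match m with
  | 1%N => family_I (- 'i) (-1) t
  | 2%N => family_I (- 'i) 1 t
  | 3%N => family_I 'i (-1) t
  | 4%N => family_I 'i 1 t
  | 5%N => family_II (-1) (- 'i) t
  | 6%N => family_II (-1) 'i t
  | 7%N => family_II 1 (- 'i) t
  | 8%N => family_II 1 'i t
  | _ => [::]
  end.

Definition coef_trace (R : realType) (D : R[i]) (n : nat) (x : T R n) : R[i] :=
  D ^+ n * eps x.

(* ord_max : 'I_n.+1 indexes the last generator of T R n.+2, which is the
   one adjoined in passing from T R n.+1. *)
Definition scalar_enhancement (R : realType)
    (r : forall n, 'I_n.-1 -> T R n) (alpha beta : R[i])
    (tr : forall n, T R n -> R[i]) : Prop :=
  [/\ alpha != 0, beta != 0,
      forall n, scalar (@tr n.+1),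
      forall n (x y : T R n.+1), tr n.+1 (x * y) = tr n.+1 (y * x)
    & forall n (x : T R n.+1),
        let rn : T R n.+2 := r n.+2 ord_max in
        [/\ rn \is a GRing.unit,
            tr n.+2 (incl x * rn) = alpha * beta * tr n.+1 x
          & tr n.+2 (incl x * rn^-1) = alpha^-1 * beta * tr n.+1 x]].

(* Main.v *)
(* Phi maps a monomial U^k to a matrix that shifts the digits of the basis
   vectors by k, so it has no diagonal entry unless k = 0: this gives
   Tr o Phi = 8^n eps_n, and with it the cyclicity of eps_n. Each r_i is
   invertible with inverse again of the form 8^(-1/2) sum_l b_l U_i^l, as the
   cyclic convolution of a and b is 8 times the unit; since eps_(n+1)(x U_n^k)
   vanishes for k <> 0, both Markov conditions only see a_0 = b_0 = 1. *)
From HB Require Import structures.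
Require Import Defs.
From mathcomp Require Import all_boot all_order all_algebra complex reals.
From mathcomp Require Import ring.

Set Implicit Arguments.
Unset Strict Implicit.
Unset Printing Implicit Defensive.

Import Order.TTheory GRing.Theory Num.Theory.
Local Open Scope ring_scope.

(** * Traces of monomials from digit shifts *)

Section Trace.
Variables (R : realType) (n : nat).
Local Notation EndV := 'M[R[i]]_#|{ffun 'I_n -> 'I_8}|.
Implicit Types (v w : {ffun 'I_n -> 'I_8}) (M N : EndV).

(** Only the support of [M] is constrained, so the phases from [Zmx] drop out and shifts simply add
    under products. *)
Definition shifts_by v M : Prop :=
  forall a b, M a b != 0 -> digits a = digits b + v.

Lemma shifts_by1 : shifts_by 0 1.
Proof.
by move=> a b; rewrite mxE; case: (a =P b) => [-> _|_]; rewrite ?addr0 ?eqxx.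
Qed.

Lemma shifts_byM v w M N :
  shifts_by v M -> shifts_by w N -> shifts_by (v + w) (M *m N).
Proof.
move=> Mv Nw a b; rewrite mxE => nz.
have [c] : exists c, M a c * N c b != 0.
  apply/existsP; apply: contraNT nz => /existsPn ab0.
  by apply/eqP/big1 => c _; apply/eqP/negPn/ab0.
by rewrite mulf_eq0 negb_or => /andP[/Mv-> /Nw->]; rewrite addrAC addrA.
Qed.

Lemma shifts_byX v M k : shifts_by v M -> shifts_by (v *+ k) (M ^+ k).
Proof.
move=> Mv; elim: k => [|k IH]; first exact: shifts_by1.
by rewrite exprS mulrS; apply: shifts_byM.
Qed.

Lemma shifts_by_prod (I : Type) (r : seq I)
    (v : I -> {ffun 'I_n -> 'I_8}) (M : I -> EndV) :
  (forall i, shifts_by (v i) (M i)) ->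
  shifts_by (\sum_(i <- r) v i) (\prod_(i <- r) M i).
Proof.
move=> Mv; elim: r => [|i r IH]; first by rewrite !big_nil; exact: shifts_by1.
by rewrite !big_cons; apply: shifts_byM.
Qed.

Lemma shifts_by_site (s : 'I_n) (A : 'M[R[i]]_8) (c : 'I_8) :
  (forall i j, A i j != 0 -> i = j + c) ->
  shifts_by [ffun l => if l == s then c else 0] (site s A).
Proof.
move=> Ac a b; rewrite mxE => nz; apply/ffunP => l; rewrite !ffunE.
move: nz; rewrite (bigD1 l) //= mulf_eq0 negb_or => /andP[nz _]; move: nz.
case: (l =P s) => [_ /Ac//|_].
by rewrite mxE addr0; case: (digits a l =P digits b l) => // _; rewrite eqxx.
Qed.

(** [Xmx] advances the left digit by one, while the diagonal [Zmx] contributes a zero shift at the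
    right site. *)
Lemma shifts_by_XZ (i : 'I_n.-1) :
  shifts_by [ffun l => if l == site_l i then 1 else 0] (XZ R i).
Proof.
rewrite -[X in shifts_by X _]addr0; apply: shifts_byM.
  by apply: shifts_by_site => j k; rewrite mxE; case: (j =P _) => // _; rewrite eqxx.
have -> : 0 = [ffun l => if l == site_r i then 0 else 0] :> {ffun 'I_n -> 'I_8}.
  by apply/ffunP => l; rewrite !ffunE if_same.
apply: shifts_by_site => j k; rewrite mxE addr0.
by case: (j =P k) => // _; rewrite mulr0n eqxx.
Qed.

Lemma shifts_by_trace v M : shifts_by v M -> v != 0 -> \tr M = 0.
Proof.
move=> Mv v0; apply: big1 => a _; apply/eqP; apply: contraNT v0 => /Mv.
by move/eqP; rewrite addrC -subr_eq subrr eq_sym.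
Qed.

(** Among all generators only [XZ i] carries [Xmx] on the factor [site_l i], so the total shift has
    digit [k i] there and a nonzero [k] gives a nonzero shift. *)
Lemma trace_monomial (k : {ffun 'I_n.-1 -> 'Z_8}) :
  k != 0 -> \tr (\prod_(i < n.-1) XZ R i ^+ k i) = 0.
Proof.
move=> k0; have sh := @shifts_by_prod _ (index_enum 'I_n.-1) _ _
  (fun i => shifts_byX (k := k i) (@shifts_by_XZ i)).
apply: (shifts_by_trace sh); apply: contraNN k0 => /eqP/ffunP sh0.
apply/eqP/ffunP => i; have := sh0 (site_l i).
rewrite sum_ffunE (bigD1 i) //= ffunMnE ffunE eqxx big1 ?addr0.
  (* ['I_8] is ['I_6.+2], and a sum of [k i] ones in it is [k i] itself. *)
  by rewrite !ffunE => <-; exact/esym/(@natr_Zp 6).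
move=> j ji; rewrite ffunMnE ffunE -val_eqE /= val_eqE eq_sym (negPf ji).
exact: mul0rn.
Qed.

Lemma trace_Phi (x : T R n) : \tr (Phi x) = coef_trace 8 x.
Proof.
have -> : \tr (Phi x) = \sum_k x k * \tr (\prod_(i < n.-1) XZ R i ^+ k i).
  by rewrite /Phi linear_sum; apply: eq_bigr => k _; exact: mxtraceZ.
rewrite (bigD1 (0 : {ffun 'I_n.-1 -> 'Z_8})) //= [X in _ + X]big1; last first.
  by move=> k k0; rewrite trace_monomial // mulr0.
rewrite addr0 big1 => [|i _]; last by rewrite ffunE expr0.
by rewrite mxtrace1 card_ffun !card_ord natrX mulrC.
Qed.

Lemma coef_trace8C (x y : T R n) : coef_trace 8 (x * y) = coef_trace 8 (y * x).
Proof. by rewrite -!trace_Phi !rmorphM; exact: mxtrace_mulC. Qed.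

End Trace.

(** * Markov property of the coefficient trace *)

Section Markov.
Variable R : realType.
Local Notation C := R[i].

Lemma eps_is_linear n : scalar (@eps R n).
Proof. by move=> a x y; rewrite /eps !ffunE. Qed.

HB.instance Definition _ n :=
  GRing.isLinear.Build C (T R n) C _ (@eps R n) (@eps_is_linear n).

Lemma eps_monomial n (m : {ffun 'I_n.-1 -> 'Z_8}) :
  eps (\prod_(i < n.-1) U R i ^+ m i) = (m == 0)%:R.
Proof.
(* [c] is the indicator of [m]; uniqueness of coefficients in the monomial basis then gives the one
   at [0]. *)
rewrite /eps eq_sym; pose c k : C := (k == m)%:R.
have /T_monomial_basis-> // : \prod_(i < n.-1) U R i ^+ m i
    = \sum_k c k *: \prod_(i < n.-1) U R i ^+ k i.
rewrite (bigD1 m) //= /c eqxx scale1r [X in _ + X]big1 ?addr0 // => k /negPf->.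
by rewrite scale0r.
Qed.

(** Appending a power of the last generator on the right keeps a monomial ordered, so each term is
    again a multiple of a basis monomial, which is 1 only when all its exponents vanish. *)
Lemma eps_incl_mulX n (x : T R n.+1) (k : 'I_8) :
  eps (incl x * U R (ord_max : 'I_n.+2.-1) ^+ k) = eps x *+ (k == 0).
Proof.
rewrite /incl mulr_suml linear_sum /=.
have e (m : {ffun 'I_n -> 'Z_8}) :
    eps ((x m *:
        \prod_(i < n) U R (widen_ord (leq_pred n.+1) i : 'I_n.+2.-1) ^+ m i)
      * U R (ord_max : 'I_n.+2.-1) ^+ k) = x m *+ ((m == 0) && (k == 0)).
  (* [m'] extends [m] by [k] in the last slot, where [unlift ord_max] returns [None]. *)
  pose m' : {ffun 'I_n.+2.-1 -> 'Z_8} :=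
    [ffun i : 'I_n.+1 => oapp m k (unlift ord_max i)].
  rewrite -scalerAl linearZ /= -[RHS]mulr_natr; congr (_ * _).
  have -> : (m == 0) && (k == 0) = (m' == 0).
    apply/andP/eqP => [[/eqP m0 /eqP k0]|/ffunP m0].
      apply/ffunP => i; rewrite !ffunE m0 k0.
      by case: unliftP => [j _|_] /=; rewrite ?ffunE.
    split; last by have := m0 ord_max; rewrite !ffunE unlift_none => /= /eqP.
    apply/eqP/ffunP => i; have := m0 (lift ord_max i).
    by rewrite !ffunE liftK.
  rewrite -eps_monomial big_ord_recr /= ffunE unlift_none; congr (eps (_ * _)).
  apply: eq_bigr => i _.
  have -> : widen_ord (leqnSn n) i = lift ord_max i.
    by apply/val_inj; rewrite /= /bump leqNgt ltn_ord.
  rewrite ffunE liftK; congr (U _ _ ^+ _).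
  by apply/val_inj; rewrite /= /bump leqNgt ltn_ord.
pose y (m : {ffun 'I_n -> 'Z_8}) : C := x m.
transitivity (\sum_m y m *+ ((m == 0) && (k == 0))).
  by apply: eq_bigr => m _; exact: e.
by rewrite (bigD1 (0 : {ffun 'I_n -> 'Z_8})) // eqxx big1 => [|m /negPf->//]; exact: addr0.
Qed.

(** The new tensor factor contributes 8 and the normalization divides by [sqrtC 8]; the quotient is
    the parameter beta. Keeping [a] arbitrary serves both the generator and its inverse. *)
Lemma coef_trace_braid_gen n (x : T R n.+1) (a : seq C) :
  coef_trace 8 (incl x * braid_gen a (ord_max : 'I_n.+2.-1))
  = a`_0 * sqrtC 8 * coef_trace 8 x.
Proof.
rewrite /coef_trace /braid_gen -scalerAr linearZ /= mulr_sumr linear_sum /=.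
rewrite (bigD1 0) //= big1 => [|k /negPf k0]; last first.
  by rewrite -scalerAr linearZ /= eps_incl_mulX k0 mulr0.
rewrite addr0 -scalerAr linearZ /= (eps_incl_mulX x 0) eqxx mulr1n exprS.
rewrite -{1}(sqrtCK 8) expr2.
have s0 : sqrtC 8 != 0 :> C by rewrite sqrtC_eq0 pnatr_eq0.
by field.
Qed.

End Markov.

(** * Inverses of the braid generators *)

Section Inverse.
Variables (R : realType).
Local Notation C := R[i].

(** This is the product of the group algebra of Z/8: [u ^+ 8 = 1] lets exponents add in ['I_8], and
    [d - k] is taken modulo 8 before being read as a list position. *)
Lemma cyclic_convolution (A : algType C) (u : A) (a b : seq C) :
  u ^+ 8 = 1 ->
  (\sum_(k < 8) a`_k *: u ^+ k) * (\sum_(k < 8) b`_k *: u ^+ k)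
  = \sum_(d < 8) (\sum_(k < 8) a`_k * b`_(d - k)%R) *: u ^+ d.
Proof.
move=> u8; under [RHS]eq_bigr => d _ do rewrite scaler_suml.
rewrite exchange_big mulr_suml; apply: eq_bigr => k _.
rewrite mulr_sumr [RHS](reindex_inj (addrI k)); apply: eq_bigr => l _.
have -> : k + l - k = l by rewrite addrC addKr.
by rewrite -scalerAl -scalerAr scalerA -exprD (expr_mod _ u8).
Qed.

Lemma braid_genM n (a b : seq C) (i : 'I_n.-1) :
  braid_gen a i * braid_gen b i = ((sqrtC 8)^-1 / sqrtC 8)
    *: ((\sum_(k < 8) a`_k *: U R i ^+ k) * (\sum_(k < 8) b`_k *: U R i ^+ k)).
Proof. by rewrite /braid_gen -scalerAl -scalerAr scalerA. Qed.

(** Both factors are polynomials in [U R i]. This turns a right inverse into the two-sided one that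
    [GRing.unit] demands. *)
Lemma braid_gen_comm n (a b : seq C) (i : 'I_n.-1) :
  braid_gen a i * braid_gen b i = braid_gen b i * braid_gen a i.
Proof.
apply: etrans (braid_genM a b i) (etrans (congr1 _ _) (esym (braid_genM b a i))).
apply: commr_sum => k _; apply/commr_sym/commr_sum => l _.
rewrite /GRing.comm -!scalerAl -!scalerAr !scalerA mulrC; congr (_ *: _).
by rewrite -!exprD addnC.
Qed.

Lemma braid_gen_inverse n (a b : seq C) (i : 'I_n.-1) :
  (forall d : 'I_8, \sum_(k < 8) a`_k * b`_(d - k)%R = 8 *+ (d == 0)) ->
  braid_gen a i \is a GRing.unit /\ (braid_gen a i)^-1 = braid_gen b i.
Proof.
move=> ab; have rs : braid_gen a i * braid_gen b i = 1.
  have [u8 _ _] := T_relationsU R n.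
  apply: etrans (braid_genM a b i) _; rewrite cyclic_convolution //.
  under eq_bigr => d _ do rewrite ab.
  rewrite (bigD1 0) // big1 => [|d /negPf->]; last exact: scale0r.
  (* The two normalizing factors multiply to 1/8 and cancel the 8 of the convolution. *)
  rewrite [X in _ *: X]addr0 eqxx mulr1n expr0 scalerA -invfM -expr2 sqrtCK.
  by rewrite mulVf ?scale1r ?pnatr_eq0.
have unit_r : braid_gen a i \is a GRing.unit.
  apply/unitrP; exists (braid_gen b i).
  by split; [exact: etrans (braid_gen_comm b a i) rs | exact: rs].
split; first exact: unit_r.
exact: etrans (esym (mulr1 _)) (etrans (congr1 _ (esym rs)) (mulKr unit_r _)).
Qed.

(* When |t| = 1 and a is the first sequence, the second one is conj (a_(-l)), so
   that the identities express the unitarity of R(a) / sqrt 8. *)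
Lemma family_I_convolution (alpha eta t : C) (d : 'I_8) :
  alpha ^+ 2 = -1 -> eta ^+ 2 = 1 -> t != 0 ->
  \sum_(k < 8) (family_I alpha eta t)`_k
    * [:: 1; t^-1; - eta; - alpha / t; -1; t^-1; eta; - alpha / t]`_(d - k)%R
  = 8 *+ (d == 0).
Proof.
move=> a2 e2 /mulfV; move: (t^-1) => s ts; move: d.
case; do 8?[case=> [?|]]; rewrite // !big_ord_recl big_ord0 /= ?mulr0n ?mulr1n.
all: ring: a2 e2 ts.
Qed.

Lemma family_II_convolution (delta beta t : C) (d : 'I_8) :
  delta ^+ 2 = 1 -> beta ^+ 2 = -1 -> t != 0 ->
  \sum_(k < 8) (family_II delta beta t)`_k
    * [:: 1; t^-1; - beta; - delta / t; 1; - t^-1; - beta; delta / t]`_(d - k)%R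
  = 8 *+ (d == 0).
Proof.
(* With [s] in place of the inverse of [t], each of the eight values of [d] gives a polynomial
   identity modulo [d2], [b2] and [t * s = 1]. *)
move=> d2 b2 /mulfV; move: (t^-1) => s ts; move: d.
case; do 8?[case=> [?|]]; rewrite // !big_ord_recl big_ord0 /= ?mulr0n ?mulr1n.
all: ring: d2 b2 ts.
Qed.

Lemma family_C_convolution (t : C) (m : nat) :
  t != 0 -> (1 <= m <= 8)%N ->
  (family_C m t)`_0 = 1 /\ exists2 b : seq C, b`_0 = 1
    & forall d : 'I_8,
        \sum_(k < 8) (family_C m t)`_k * b`_(d - k)%R = 8 *+ (d == 0).
Proof.
move=> t0; have i2 : 'i ^+ 2 = -1 :> C by exact: sqrCi.
have ni2 : (- 'i) ^+ 2 = -1 :> C by rewrite sqrrN.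
have n1 : (-1) ^+ 2 = 1 :> C by rewrite sqrrN expr1n.
have p1 : 1 ^+ 2 = 1 :> C by rewrite expr1n.
do 9?[case: m => [|m] //] => _; split=> //; eexists;
  try (by move=> d; first
    [apply: family_I_convolution | apply: family_II_convolution]); by [].
Qed.

End Inverse.

Theorem corollary7p4 (R : realType) (t : R[i]) (m : nat)
    (ht : `|t| = 1) (hm : (1 <= m <= 8)%N) :
  (forall (n : nat) (x : T R n.+1), \tr (Phi x) = coef_trace 8 x) /\
  scalar_enhancement (fun n => @braid_gen R n (family_C m t)) 1 (sqrtC 8)
    (@coef_trace R 8).
Proof.
split=> [n x|]; first exact: trace_Phi.
have t0 : t != 0 by rewrite -normr_gt0 ht ltr01.
have [a0 [b b0 ab]] := family_C_convolution t0 hm.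
split=> [|||n x y|n x /=].
- exact: oner_neq0.
- by rewrite sqrtC_eq0 pnatr_eq0.
- by move=> n c x y; rewrite /coef_trace linearP mulrDr mulrCA.
- exact: coef_trace8C.
have [unit_r ->] := braid_gen_inverse (ord_max : 'I_n.+2.-1) ab.
(* Since alpha is 1, both Markov conditions ask for the same factor [sqrtC 8], that is, for a zeroth
   coefficient equal to 1. *)
rewrite invr1; split; first exact: unit_r.
  by apply: etrans (coef_trace_braid_gen x _) _; rewrite a0.
by apply: etrans (coef_trace_braid_gen x _) _; rewrite b0.
Qed.
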